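(* Let $X$ be a Hilbert space and let $T\in B(X)$ have a core inverse $T^{\#}\in B(X)$. Let $\delta T\in B(X)$ be such that $I+T^{\#}\delta T: X\to X$ is invertible, and put $\overline{T}=T+\delta T$. Then, for the operator $$B=T^{\#}(I+\delta T\,T^{\#})^{-1}=(I+T^{\#}\delta T)^{-1}T^{\#}$$ (both expressions being well defined and equal), the following conditions are equivalent: (i) $B$ is a core inverse of $\overline{T}$; (ii) $R(\overline{T})\subseteq R(T)$; (iii) $R(\overline{T})=R(T)$; (iv) $TT^{\#}\overline{T}=\overline{T}$; (v) $TT^{\#}\delta T=\delta T$. In this case, $\overline{T}B=TT^{\#}$, $$\|B\|\le \|T^{\#}\|\cdot\|(I+T^{\#}\delta T)^{-1}\|,$$ and $$\|B-T^{\#}\|\le \|T^{\#}\|\cdot\|(I+T^{\#}\delta T)^{-1}\|\cdot\|T^{\#}\delta T\|.$$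
   Context: $B(X)$ is the Banach space of all bounded linear operators from the Hilbert space $X$ into itself, with the operator norm; $I$ is the identity operator; $R(A)$ and $N(A)$ denote the range and null space of $A$; $A^*$ is the Hilbert space adjoint. For $A\in B(X)$, an operator $S\in B(X)$ is called a core inverse of $A$ if $ASA=A$, $R(S)=R(A)$ and $N(S)=N(A^* )$. It is a known result (Rakić, Dinčić, Djordjević) that this is equivalent to $S$ satisfying the five equations (1) $ASA=A$, (2) $SAS=S$, (3) $(AS)^*=AS$, (6) $SA^2=A$, (7) $AS^2=S$. Here $T^{\#}$ denotes the core inverse of $T$ (not the group inverse). *)

(* Defs.v *)
From HB Require Import structures.
From mathcomp Require Import all_boot all_order all_algebra.
From mathcomp Require Import complex ring lra.
From mathcomp Require Import all_classical all_reals all_analysis.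

Set Implicit Arguments.
Unset Strict Implicit.
Unset Printing Implicit Defensive.

Import Order.TTheory GRing.Theory Num.Theory.
Import numFieldNormedType.Exports.

Local Open Scope classical_set_scope.
Local Open Scope ring_scope.

(* Hilbert spaces over the reals and over the complex numbers are treated
   uniformly: the scalar field is R or R[i], according to k.  Norms take their
   values in the scalar field, and scalar_re brings them back to R. *)
Variant scalar_kind := RealScalars | ComplexScalars.

Definition scalars (R : realType) (k : scalar_kind) : numFieldType :=
  match k with RealScalars => R | ComplexScalars => R[i] end.

Definition scalar_conj (R : realType) (k : scalar_kind) :
    scalars R k -> scalars R k :=
  match k with
  | RealScalars => idfun
  | ComplexScalars => @Num.conj R[i]
  end.

Definition scalar_re (R : realType) (k : scalar_kind) : scalars R k -> R :=
  match k with
  | RealScalars => idfun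
  | ComplexScalars => @complex.Re R
  end.

Record hilbertType (R : realType) (k : scalar_kind) := HilbertType {
  hilbert_sort :> completeNormedModType (scalars R k);
  inner : {dot hilbert_sort for @scalar_conj R k};
  inner_norm : forall x, inner x x = `|x| ^+ 2 }.

(* B(X) *)
Record bop (R : realType) (k : scalar_kind) (X : hilbertType R k) := Bop {
  bop_fun :> X -> X;
  bop_linear : linear bop_fun;
  bop_bounded : bounded_near bop_fun (nbhs (0 : X)) }.

Section BoundedOperators.
Context {R : realType} {k : scalar_kind} {X : hilbertType R k}.
Implicit Types (S T U : bop X) (x y : X).

HB.instance Definition _ := gen_eqMixin (bop X).
HB.instance Definition _ := gen_choiceMixin (bop X).
HB.instance Definition _ T :=
  GRing.isLinear.Build (scalars R k) X X _ T (bop_linear T).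

Lemma bopP S T : S =1 T -> S = T.
Proof.
case: S T => [f lf bf] [g lg bg] /= /funext fg.
by case: _ / fg in lg bg *; congr Bop; exact: Prop_irrelevance.
Qed.

Lemma bop_continuous T : continuous T.
Proof. exact: (bounded_linear_continuous (@bop_bounded _ _ _ T)). Qed.

Let continuous_bounded (f : {linear X -> X}) :
  continuous f -> bounded_near f (nbhs (0 : X)).
Proof. by move/linear_bounded_continuous. Qed.

Let bop_of (f : {linear X -> X}) (cf : continuous f) : bop X :=
  Bop (@linearP _ _ _ _ f) (continuous_bounded cf).

Let bop0 : bop X := bop_of (f := \0 : {linear X -> X}) (fun x => cvg_cst 0).

Let bop1 : bop X := bop_of (f := idfun : {linear X -> X}) (fun x => cvg_id).

Let bop_add S T : bop X := bop_of (f := S \+ T : {linear X -> X})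
  (fun x => cvgD (@bop_continuous S x) (@bop_continuous T x)).

Let bop_opp S : bop X := bop_of (f := \- S : {linear X -> X})
  (fun x => cvgN (@bop_continuous S x)).

Let bop_comp S T : bop X := bop_of (f := S \o T : {linear X -> X})
  (fun x => continuous_comp (@bop_continuous T x) (@bop_continuous S (T x))).

Fact bop_addA : associative bop_add.
Proof. by move=> S T U; apply: bopP => x /=; rewrite addrA. Qed.
Fact bop_addC : commutative bop_add.
Proof. by move=> S T; apply: bopP => x /=; rewrite addrC. Qed.
Fact bop_add0 : left_id bop0 bop_add.
Proof. by move=> S; apply: bopP => x /=; rewrite add0r. Qed.
Fact bop_addN : left_inverse bop0 bop_opp bop_add.
Proof. by move=> S; apply: bopP => x /=; rewrite addNr. Qed.

HB.instance Definition _ :=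
  GRing.isZmodule.Build (bop X) bop_addA bop_addC bop_add0 bop_addN.

Fact bop_compA : associative bop_comp.
Proof. by move=> S T U; apply: bopP. Qed.
Fact bop_1comp : left_id bop1 bop_comp.
Proof. by move=> S; apply: bopP. Qed.
Fact bop_comp1 : right_id bop1 bop_comp.
Proof. by move=> S; apply: bopP. Qed.
Fact bop_compDl : left_distributive bop_comp bop_add.
Proof. by move=> S T U; apply: bopP. Qed.
Fact bop_compDr : right_distributive bop_comp bop_add.
Proof. by move=> S T U; apply: bopP => x /=; rewrite linearD. Qed.

(* The product is composition.  There is no nzRing structure, since X may be
   the zero space; hence inverses are not those of unitRingType. *)
HB.instance Definition _ := GRing.Zmodule_isPzRing.Build (bop X)
  bop_compA bop_1comp bop_comp1 bop_compDl bop_compDr.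

Lemma bopDE S T x : (S + T) x = S x + T x. Proof. by []. Qed.
Lemma bopNE S x : (- S) x = - S x. Proof. by []. Qed.
Lemma bop0E x : (0 : bop X) x = 0. Proof. by []. Qed.
Lemma bopME S T x : (S * T) x = S (T x). Proof. by []. Qed.
Lemma bop1E x : (1 : bop X) x = x. Proof. by []. Qed.

Definition is_inverse T S := T * S = 1 /\ S * T = 1.

Definition invertible T := exists S, is_inverse T S.

(* 0 is a junk value, for operators that are not invertible *)
Definition bop_inv T : bop X := xget 0 (is_inverse T).

Definition op_norm T : R :=
  sup [set scalar_re `|T x| | x in [set y : X | `|y| <= 1]].

Definition null_space T : set X := [set x | T x = 0].

Definition is_adjoint T S := forall x y, inner X (T x) y = inner X x (S y).

(* 0 is never used: adjointP shows that the adjoint exists *)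
Definition adjoint T : bop X := xget 0 (is_adjoint T).

Definition core_inverse T S :=
  [/\ T * S * T = T, range S = range T & null_space S = null_space (adjoint T)].

End BoundedOperators.

Section Scalars.
Context {R : realType} {k : scalar_kind}.
Implicit Types a b : scalars R k.

Lemma scalar_conj_zmod : zmod_morphism (@scalar_conj R k).
Proof. by case: k => // x y; rewrite /= rmorphB. Qed.

Lemma scalar_conj_monoid : monoid_morphism (@scalar_conj R k).
Proof. by case: k => //; split=> [|x y] /=; rewrite ?rmorph1 ?rmorphM. Qed.

HB.instance Definition _ :=
  GRing.isZmodMorphism.Build _ _ (@scalar_conj R k) scalar_conj_zmod.
HB.instance Definition _ :=
  GRing.isMonoidMorphism.Build _ _ (@scalar_conj R k) scalar_conj_monoid.

Lemma scalar_normCK a : `|a| ^+ 2 = a * scalar_conj a.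
Proof.
by move: a; case: k => a; [exact: real_normK (num_real _)|exact: normCK].
Qed.

Lemma scalar_conjK a : scalar_conj (scalar_conj a) = a.
Proof. by move: a; case: k => a //; exact: conjCK. Qed.

Lemma scalar_conj_ge0 a : 0 <= a -> scalar_conj a = a.
Proof. by move: a; case: k => a // a0; apply: conj_Creal; exact: ger0_real. Qed.

Lemma scalar_reD a b : scalar_re (a + b) = scalar_re a + scalar_re b.
Proof. by move: a b; case: k => // -[a ?] [b ?]. Qed.

Lemma scalar_reN a : scalar_re (- a) = - scalar_re a.
Proof. by move: a; case: k => // -[a ?]. Qed.

Lemma scalar_re0 : scalar_re (0 : scalars R k) = 0.
Proof. by case: k. Qed.

Lemma scalar_re1 : scalar_re (1 : scalars R k) = 1.
Proof. by case: k. Qed.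

Lemma scalar_reMn a n : scalar_re (a *+ n) = scalar_re a *+ n.
Proof.
by elim: n => [|n IH]; rewrite ?mulr0n ?scalar_re0// !mulrS scalar_reD IH.
Qed.

Lemma scalar_re_le a b : a <= b -> scalar_re a <= scalar_re b.
Proof.
move: a b; case: k => //= -[a ai] [b bi].
by rewrite lecE => /andP[].
Qed.

Lemma scalar_re_lt a b : 0 <= a -> 0 <= b ->
  (scalar_re a < scalar_re b) = (a < b).
Proof.
move: a b; case: k => //= -[a ai] [b bi].
by rewrite !lecE ltcE /= => /andP[/eqP -> _] /andP[/eqP -> _]; rewrite eqxx.
Qed.

Lemma scalar_re_leE a b : 0 <= a -> 0 <= b ->
  (scalar_re a <= scalar_re b) = (a <= b).
Proof.
move: a b; case: k => //= -[a ai] [b bi].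
by rewrite !lecE /= => /andP[/eqP -> _] /andP[/eqP -> _]; rewrite eqxx.
Qed.

Lemma scalar_reM a b : 0 <= a -> scalar_re (a * b) = scalar_re a * scalar_re b.
Proof.
move: a b; case: k => //= -[a ai] [b bi].
by rewrite lecE /= => /andP[/eqP -> _]; rewrite mul0r subr0.
Qed.

Lemma scalar_re_ge0 a : 0 <= a -> 0 <= scalar_re a.
Proof. by move=> /scalar_re_le; rewrite scalar_re0. Qed.

Lemma scalar_re_gt0 a : 0 < a -> 0 < scalar_re a.
Proof. by move=> a0; rewrite -scalar_re0 scalar_re_lt// ltW. Qed.

End Scalars.

Section Riesz.
Context {R : realType} {k : scalar_kind} {X : hilbertType R k}.
Implicit Types (x y z : X) (a b : scalars R k).
Local Notation K := (scalars R k).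
Local Notation "''[' u , v ]" := (inner X u v).
Local Notation conj := (@scalar_conj R k).

Lemma innerC x y : '[x, y] = conj '[y, x].
Proof. by have := hermC (inner X) x y; rewrite expr0 mul1r. Qed.

Lemma innerDl x y z : '[x + y, z] = '[x, z] + '[y, z].
Proof. exact: linearDl. Qed.

Lemma innerDr x y z : '[x, y + z] = '[x, y] + '[x, z].
Proof. exact: linearDr. Qed.

Lemma innerZl a x y : '[a *: x, y] = a * '[x, y].
Proof. exact: linearZl. Qed.

Lemma innerZr a x y : '[x, a *: y] = conj a * '[x, y].
Proof. by rewrite innerC innerZl rmorphM/= -innerC. Qed.

Lemma innerNl x y : '[- x, y] = - '[x, y].
Proof. by rewrite -scaleN1r innerZl mulN1r. Qed.

Lemma innerNr x y : '[x, - y] = - '[x, y].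
Proof. by rewrite -scaleN1r innerZr rmorphN1 mulN1r. Qed.

Lemma inner0l x : '[0, x] = 0.
Proof. by rewrite -(scale0r x) innerZl mul0r. Qed.

Lemma inner_eqr u v : (forall x, '[x, u] = '[x, v]) -> u = v.
Proof.
move=> /(_ (u - v)) /eqP; rewrite -subr_eq0 -innerNr -innerDr inner_norm.
by rewrite expf_eq0 /= normr_eq0 subr_eq0 => /eqP.
Qed.

Lemma parallelogram x y :
  `|x + y| ^+ 2 + `|x - y| ^+ 2 = `|x| ^+ 2 *+ 2 + `|y| ^+ 2 *+ 2.
Proof.
rewrite -!inner_norm !(innerDl, innerDr, innerNl, innerNr); ring.
Qed.

Lemma proj_norm x y : y != 0 ->
  `|x - ('[x, y] / `|y| ^+ 2) *: y| ^+ 2 =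
  `|x| ^+ 2 - `|'[x, y]| ^+ 2 / `|y| ^+ 2.
Proof.
move=> y0; have ny0 : `|y| != 0 by rewrite normr_eq0.
have cy : conj (`|y| ^+ 2)^-1 = (`|y| ^+ 2)^-1.
  by rewrite scalar_conj_ge0// invr_ge0 exprn_ge0.
rewrite -[LHS]inner_norm.
rewrite !(innerDl, innerDr, innerNl, innerNr, innerZl, innerZr).
rewrite !inner_norm rmorphM /= cy [`|'[x, y]| ^+ 2]scalar_normCK (innerC y x).
have n0 : `|y| ^+ 2 != 0 by rewrite expf_eq0.
move: (`|x| ^+ 2) (`|y| ^+ 2) ('[x, y]) (conj _) n0 => m n p q n0.
rewrite addrA.
have -> : p / n * (q / n * n) = p * q / n by rewrite divfK// mulrAC.
have -> : p / n * q = p * q / n by rewrite mulrAC.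
have -> : q / n * p = p * q / n by rewrite mulrAC (mulrC q).
by rewrite ?opprK; ring.
Qed.

Lemma cauchy_schwarz x y : `|'[x, y]| <= `|x| * `|y|.
Proof.
have [->|y0] := eqVneq y 0.
  by rewrite -(scale0r (0:X)) innerZr rmorph0 mul0r normr0 mulr_ge0.
rewrite -(ler_pXn2r (n := 2)) ?nnegrE ?mulr_ge0//.
have ny0 : 0 < `|y| ^+ 2 by rewrite exprn_gt0// normr_gt0.
rewrite exprMn -ler_pdivrMr// -subr_ge0 -proj_norm//; exact: exprn_ge0.
Qed.

Let r x : R := scalar_re `|x|.

Let r_ge0 x : 0 <= r x. Proof. exact/scalar_re_ge0. Qed.

Let rD x y : r (x + y) <= r x + r y.
Proof. by rewrite /r -scalar_reD; apply: scalar_re_le; exact: ler_normD. Qed.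

Let r_par x y : r (x + y) ^+ 2 + r (x - y) ^+ 2 = r x ^+ 2 *+ 2 + r y ^+ 2 *+ 2.
Proof.
have rsq z : r z ^+ 2 = scalar_re (`|z| ^+ 2) by rewrite !expr2 scalar_reM.
by rewrite !rsq -scalar_reD parallelogram scalar_reD !scalar_reMn.
Qed.

Let r_half x : r (2^-1 *: x) = r x / 2.
Proof.
have -> : r x = r (2^-1 *: x) *+ 2; last by field.
rewrite /r -scalar_reMn normrZ ger0_norm ?invr_ge0//; congr scalar_re.
by rewrite -mulrnAl -(mulr_natr 2^-1) mulVf ?mul1r.
Qed.

Section representation.
Context (phi : X -> K) (M : K) (M0 : 0 < M).
Context (phiD : forall x y, phi (x + y) = phi x + phi y).
Context (phiZ : forall a x, phi (a *: x) = a * phi x).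
Context (phiM : forall x, `|phi x| <= M * `|x|).

Let C : set X := [set x | phi x = 1].
Context (c0 : X) (Cc0 : C c0).

Let d := inf (r @` C).
Let hd : has_inf (r @` C).
Proof. by split; [exists (r c0), c0|exists 0 => _ [x _ <-]]. Qed.

Let d_le x : C x -> d <= r x.
Proof. by move=> Cx; apply: (ge_inf hd.2); exists x. Qed.

Let d_ge0 : 0 <= d.
Proof. by apply: lb_le_inf; [exact: hd.1|move=> _ [x _ <-]]. Qed.

Let seqP n : exists x, C x /\ r x < d + n.+1%:R^-1.
Proof.
have e0 : 0 < n.+1%:R^-1 :> R by rewrite invr_gt0.
have [_ [x Cx <-] lx] := inf_adherent e0 hd.
by exists x.
Qed.

Let u n := projT1 (cid (seqP n)).
Let Cu n : C (u n). Proof. by rewrite /u; case: cid => x []. Qed.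

Let ru n : r (u n) < d + n.+1%:R^-1.
Proof. by rewrite /u; case: cid => x []. Qed.

Let ru2 n m N : (N <= n)%N -> (N <= m)%N ->
  r (u n - u m) ^+ 2 <= (8 * d + 4) * N.+1%:R^-1.
Proof.
move=> Nn Nm; set e : R := N.+1%:R^-1.
have e0 : 0 < e by rewrite invr_gt0.
have e1 : e <= 1 by rewrite invf_le1// ler1n.
have ub l : (N <= l)%N -> r (u l) <= d + e.
  move=> Nl; apply: le_trans (ltW (ru l)) _; rewrite lerD2l lef_pV2 ?posrE//.
  by rewrite ler_nat.
have := r_par (u n) (u m).
have hC : C (2^-1 *: (u n + u m)).
  by rewrite /C /= phiZ phiD !Cu mulVf.
have := d_le hC; rewrite r_half.
have := ub _ Nn; have := ub _ Nm.
have := r_ge0 (u n); have := r_ge0 (u m).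
set a := r (u n); set b := r (u m); set s := r (u n + u m); set t := r (_ - _).
have := d_ge0.
move=> d0 b0 a0 hb ha hs pl.
have s2 : 4 * d ^+ 2 <= s ^+ 2 by rewrite !expr2; nra.
have a2 : a ^+ 2 <= (d + e) ^+ 2 by rewrite !expr2; nra.
have b2 : b ^+ 2 <= (d + e) ^+ 2 by rewrite !expr2; nra.
have ee : e ^+ 2 <= e by rewrite expr2; nra.
have -> : t ^+ 2 = a ^+ 2 *+ 2 + b ^+ 2 *+ 2 - s ^+ 2 by rewrite -pl; ring.
rewrite !mulr2n; nra.
Qed.

Let small (eps : R) : 0 < eps -> exists N : nat, N.+1%:R^-1 < eps.
Proof.
move=> e0; exists (Num.truncn eps^-1); rewrite invf_plt ?posrE//.
exact: truncnS_gt.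
Qed.

Let cvu : cvg (u @ \oo).
Proof.
apply: cauchy_cvg; apply: cauchy_exP => e e0.
have re0 := scalar_re_gt0 e0.
have D0 : 0 < 8 * d + 4 by have := d_ge0; lra.
have [|N hN] := @small (scalar_re e ^+ 2 / (8 * d + 4)).
  by rewrite divr_gt0// exprn_gt0.
exists (u N), N => // n /= Nn.
rewrite -ball_normE /= -scalar_re_lt; [|exact: normr_ge0|exact: ltW].
rewrite -(ltr_pXn2r (n := 2)) ?nnegrE; [|by []|exact: r_ge0|exact: ltW].
apply: le_lt_trans (ru2 (leqnn N) Nn) _.
by rewrite mulrC -ltr_pdivlMr.
Qed.

Let z := lim (u @ \oo).

Let zu (e : K) : 0 < e -> exists N, forall n, (N <= n)%N -> `|z - u n| < e.
Proof.
move=> e0; have /cvgrPdist_lt /(_ _ e0) [N _ hN] : u @ \oo --> z by exact: cvu.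
by exists N => n Nn; apply: hN.
Qed.

Let Cz : phi z = 1.
Proof.
apply/eqP; rewrite -subr_eq0 -normr_eq0; apply/eqP/le_anti.
rewrite normr_ge0 andbT.
apply/ler_addgt0Pr => e e0; rewrite add0r.
have [|N hN] := @zu (e / M); first by rewrite divr_gt0.
have /ltW h := hN N (leqnn N).
have -> : phi z - 1 = phi (z - u N).
  by rewrite phiD -(scaleN1r (u N)) phiZ mulN1r Cu.
apply: le_trans (phiM _) _; rewrite mulrC -ler_pdivlMr//.
Qed.

Let zmin x : C x -> r z <= r x.
Proof.
move=> Cx; apply/ler_addgt0Pr => e e0.
have [|N1 h1] := @small (e / 2); first by rewrite divr_gt0.
have eC : exists2 e' : K, 0 < e' & scalar_re e' <= e / 2.
  exists N1.+1%:R^-1; first by rewrite invr_gt0.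
  apply: le_trans (ltW h1); rewrite le_eqVlt; apply/orP; left; apply/eqP.
  have n0 : N1.+1%:R != 0 :> R by [].
  apply: (mulfI n0); rewrite mulfV//.
  have := @scalar_reM R k N1.+1%:R N1.+1%:R^-1 (ler0n _ _).
  by rewrite mulfV// scalar_re1 scalar_reMn scalar_re1 => <-.
have [e' e'0 he'] := eC.
have [N2 h2] := zu e'0.
have h3 := h2 (maxn N1 N2) (leq_maxr _ _).
have h4 := ru (maxn N1 N2).
have h5 : (maxn N1 N2).+1%:R^-1 <= N1.+1%:R^-1 :> R.
  by rewrite lef_pV2 ?posrE// ler_nat ltnS leq_maxl.
have h6 := d_le Cx.
have h7 : r (z - u (maxn N1 N2)) <= e / 2.
  by apply: le_trans he'; apply: scalar_re_le; exact: ltW.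
have := rD (z - u (maxn N1 N2)) (u (maxn N1 N2)); rewrite subrK.
move: h1 h4 h5 h6 h7; move: (N1.+1%:R^-1) ((maxn N1 N2).+1%:R^-1).
move: (r (z - _)) (r (u _)) (r z) (r x) d.
move=> a b c f g h l; lra.
Qed.

Lemma riesz_aux : exists y, forall x, phi x = '[x, y].
Proof.
have z0 : z != 0.
  apply/eqP => z0; have := Cz; rewrite z0 -(scale0r (0 : X)) phiZ mul0r => /eqP.
  by rewrite eq_sym oner_eq0.
have ker h : phi h = 0 -> '[z, h] = 0.
  move=> ph; have [->|h0] := eqVneq h 0.
    by rewrite -(scale0r (0:X)) innerZr rmorph0 mul0r.
  set w := z - ('[z, h] / `|h| ^+ 2) *: h.
  have Cw : C w by rewrite /C/= /w -scaleNr phiD phiZ ph mulr0 addr0 Cz.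
  have := zmin Cw; rewrite scalar_re_leE// -(ler_pXn2r (n := 2)) ?nnegrE//.
  rewrite proj_norm// lerDl oppr_ge0 => le0.
  have h2 : 0 < `|h| ^+ 2 by rewrite exprn_gt0// normr_gt0.
  move: le0; rewrite pmulr_lle0 ?invr_gt0// => le0.
  have : `|'[z, h]| ^+ 2 == 0 by rewrite eq_le le0 exprn_ge0.
  by rewrite expf_eq0 /= normr_eq0 => /eqP.
have nz : `|z| ^+ 2 != 0 by rewrite expf_eq0 /= normr_eq0.
exists ((`|z| ^+ 2)^-1 *: z) => x.
rewrite innerZr scalar_conj_ge0 ?invr_ge0 ?exprn_ge0//.
have /ker : phi (x - phi x *: z) = 0.
  by rewrite -scaleNr phiD phiZ Cz mulr1 subrr.
rewrite innerC => /(congr1 conj); rewrite scalar_conjK rmorph0.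
rewrite innerDl innerNl innerZl inner_norm => /eqP; rewrite subr_eq0 => /eqP ->.
by rewrite mulrCA mulVf ?mulr1.
Qed.

End representation.

Lemma riesz (phi : X -> K) (M : K) :
  (forall x y, phi (x + y) = phi x + phi y) ->
  (forall a x, phi (a *: x) = a * phi x) ->
  0 < M -> (forall x, `|phi x| <= M * `|x|) ->
  exists y, forall x, phi x = '[x, y].
Proof.
move=> phiD phiZ M0 phiM.
have [[x px]|/forallNP nx] := pselect (exists x, phi x <> 0).
  apply: (riesz_aux M0 phiD phiZ phiM (c0 := (phi x)^-1 *: x)).
  by rewrite /= phiZ mulVf//; exact/eqP.
exists 0 => x; rewrite -(scale0r (0:X)) innerZr rmorph0 mul0r.
by apply: contrapT; exact: nx.
Qed.

Let op_bound (T : bop X) : exists2 M : K, 0 < M & forall x, `|T x| <= M * `|x|.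
Proof.
have := @bop_bounded _ _ _ T => /(linear_boundedP T)/pinfty_ex_gt0[M M0 hM].
by exists M.
Qed.

Lemma adjoint_ex (T : bop X) : exists S, is_adjoint T S.
Proof.
have [M M0 hM] := op_bound T.
have ex y : exists w, forall x, '[T x, y] = '[x, w].
  apply: (@riesz (fun x => '[T x, y]) (M * (`|y| + 1))).
  - by move=> x x'; rewrite linearD innerDl.
  - by move=> a x; rewrite linearZ/= innerZl.
  - by rewrite mulr_gt0// ltr_pwDr.
  - move=> x; apply: le_trans (cauchy_schwarz _ _) _.
    rewrite mulrAC ler_pM//; by rewrite ler_wpDr.
have [S hS] := choice ex.
have linS : linear S.
  move=> a y y'; apply: inner_eqr => x.
  by rewrite innerDr innerZr -!hS innerDr innerZr.
pose S' : {linear X -> X} := HB.pack S (GRing.isLinear.Build _ _ _ _ _ linS).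
have bS : bounded_near S (nbhs (0 : X)).
  apply/(linear_boundedP S'); exists M; split; first exact: gtr0_real.
  move=> N /ltW MN y /=; apply: (@le_trans _ _ (M * `|y|)); last first.
    by rewrite ler_wpM2r.
  have [->|Sy0] := eqVneq (S y) 0; first by rewrite normr0 mulr_ge0// ltW.
  rewrite -(ler_pM2l (x := `|S y|)) ?normr_gt0// -expr2 -inner_norm -hS.
  have := cauchy_schwarz (T (S y)) y.
  rewrite ger0_norm; last by rewrite hS inner_norm exprn_ge0.
  move=> /le_trans; apply; rewrite mulrA (mulrC `|S y|).
  by rewrite ler_wpM2r.
by exists (Bop linS bS) => x y; rewrite hS.
Qed.

Lemma adjointP (T : bop X) : is_adjoint T (adjoint T).
Proof. by have [S hS] := adjoint_ex T; apply: (xgetI _ hS). Qed.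

Lemma op_norm_has_sup (T : bop X) :
  has_sup [set scalar_re `|T x| | x in [set y : X | `|y| <= 1]].
Proof.
split; first by exists (scalar_re `|T 0|), 0 => //=; rewrite normr0.
have [M M0 hM] := op_bound T.
exists (scalar_re M) => _ [x /= x1 <-]; apply: scalar_re_le.
by apply: le_trans (hM x) _; rewrite ler_piMr// ltW.
Qed.

End Riesz.

(* Main.v *)
Require Import Defs.
From mathcomp Require Import all_boot all_order all_algebra.
From mathcomp Require Import complex.
From mathcomp Require Import all_classical all_reals all_analysis.

Set Implicit Arguments.
Unset Strict Implicit.
Unset Printing Implicit Defensive.

Import Order.TTheory GRing.Theory Num.Theory.
Import numFieldNormedType.Exports.

Local Open Scope classical_set_scope.
Local Open Scope ring_scope.

(** Write [U] for the inverse of [1 + Ts * dT].  Jacobson's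
    identity gives [1 - dT * U * Ts] as the inverse of [1 + dT * Ts], and
    [(1 + Ts * dT) * Ts = Ts * (1 + dT * Ts)] makes the two expressions of [B]
    agree.  Since [B] is [Ts] followed or preceded by an invertible operator,
    it keeps both the range and the null space of [Ts].

    If [B] is a core inverse of [Tb], the two have the same range, and likewise
    [Ts] and [T]; as [B] and [Ts] share theirs, [range Tb = range T].
    Conversely [T * Ts] is an idempotent with range [range T], so that
    [range Tb] lies in [range T] exactly when [T * Ts] fixes [Tb], or
    equivalently [dT].  Then [Tb = T * (1 + Ts * dT)], whence [range Tb = range T]
    and [Tb * B = T * Ts]; and as the null space of an adjoint is the
    orthogonal complement of the range ([null_adjointP]), the null space
    condition passes from [Ts] to [B].

    The estimates follow from [B = U * Ts] and [B - Ts = - (U * (Ts * dT) * Ts)]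
    by submultiplicativity of the operator norm. *)

(** * Invertible operators *)

Section Inverses.
Context {R : realType} {k : scalar_kind} {X : hilbertType R k}.
Implicit Types (A C S D U V : bop X).

Lemma bop_invP A : invertible A -> is_inverse A (bop_inv A).
Proof. by case=> S AS; exact: (xgetI _ AS). Qed.

(** Jacobson's lemma: [1 - D * U * S] is what the formal geometric series for
    the inverse of [1 + D * S] gives after factoring [D] and [S] out. *)
Lemma invertible_swap S D : invertible (1 + S * D) -> invertible (1 + D * S).
Proof.
case=> U [SDU USD]; exists (1 - D * U * S); split.
  rewrite mulrBr mulr1 mulrDl mul1r.
  have -> : D * U * S + D * S * (D * U * S) = D * ((1 + S * D) * U) * S.
    by rewrite mulrDl mul1r mulrDr mulrDl !mulrA.
  by rewrite SDU mulr1 addrK.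
rewrite mulrBl mul1r mulrDr mulr1.
have -> : D * U * S + D * U * S * (D * S) = D * (U * (1 + S * D)) * S.
  by rewrite mulrDr mulr1 mulrDr mulrDl !mulrA.
by rewrite USD mulr1 addrK.
Qed.

Lemma inverse_swap S D U V :
  is_inverse (1 + S * D) U -> is_inverse (1 + D * S) V -> S * V = U * S.
Proof.
move=> [_ USD] [DSV _].
have SDS : (1 + S * D) * S = S * (1 + D * S).
  by rewrite mulrDl mulrDr mul1r mulr1 mulrA.
by rewrite -[LHS]mul1r -USD -mulrA (mulrA _ S V) SDS -(mulrA S) DSV mulr1.
Qed.

Lemma range_mulr A C V : is_inverse C V -> range (A * C) = range A.
Proof.
move=> [CV _]; apply/seteqP; split=> _ [x _ <-]; first by exists (C x).
by exists (V x) => //; rewrite -bopME -mulrA CV mulr1.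
Qed.

Lemma null_space_mull A C V :
  is_inverse C V -> null_space (C * A) = null_space A.
Proof.
move=> [_ VC]; apply/seteqP; split=> x CAx.
  by rewrite /null_space /= -(bop1E (A x)) -VC bopME (CAx : C (A x) = 0) linear0.
by rewrite /null_space /= (CAx : A x = 0) linear0.
Qed.

Lemma is_inverseC A C : is_inverse A C -> is_inverse C A.
Proof. by case. Qed.

End Inverses.

(** * Ranges and null spaces *)

Section Ranges.
Context {R : realType} {k : scalar_kind} {X : hilbertType R k}.
Implicit Types (A S T : bop X).

(** The null space of the adjoint is the orthogonal complement of the range;
    hence it depends on the range alone. *)
Lemma null_adjointP A x :
  null_space (adjoint A) x <-> forall y, inner X (A y) x = 0.
Proof.
split=> [Ax y|Ax]; first by rewrite adjointP Ax innerC inner0l rmorph0.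
by apply: inner_eqr => y; rewrite -adjointP Ax innerC inner0l rmorph0.
Qed.

Lemma null_adjoint_range A T :
  range A = range T -> null_space (adjoint A) = null_space (adjoint T).
Proof.
have sub (C D : bop X) : range C `<=` range D ->
    null_space (adjoint D) `<=` null_space (adjoint C).
  move=> CD x /null_adjointP Dx; apply/null_adjointP => y.
  by have [|z _ <-] := CD (C y); [exists y|].
by move=> e; apply/seteqP; split; apply: sub; rewrite e.
Qed.

(** With [S] an inner inverse of [T], [T * S] is a projection onto [range T]. *)
Lemma range_sub_inner_inverse T S A :
  T * S * T = T -> range A `<=` range T <-> T * S * A = A.
Proof.
move=> TST; split=> [AT|<- _ [x _ <-]]; last by exists (S (A x)).
apply: bopP => x; have [|y _ Ty] := AT (A x); first by exists x.
by rewrite bopME -Ty -bopME TST.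
Qed.

End Ranges.

(** * The operator norm *)

Section OperatorNorm.
Context {R : realType} {k : scalar_kind} {X : hilbertType R k}.
Implicit Types (S T : bop X) (x : X).

Lemma op_norm_ball T x : `|x| <= 1 -> scalar_re `|T x| <= op_norm T.
Proof. by move=> x1; apply: (ub_le_sup (op_norm_has_sup T).2); exists x. Qed.

Lemma op_norm_ge0 T : 0 <= op_norm T.
Proof.
apply: le_trans (op_norm_ball T (x := 0) _); last by rewrite normr0.
by apply: scalar_re_ge0.
Qed.

Lemma op_norm_le T (M : R) :
  (forall x, `|x| <= 1 -> scalar_re `|T x| <= M) -> op_norm T <= M.
Proof.
move=> TM; apply: ge_sup; first exact: (op_norm_has_sup T).1.
by move=> _ [x /= x1 <-]; exact: TM.
Qed.

Lemma op_normP T x : scalar_re `|T x| <= op_norm T * scalar_re `|x|.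
Proof.
have [->|x0] := eqVneq x 0; first by rewrite linear0 normr0 scalar_re0 mulr0.
have nx0 : `|x| != 0 by rewrite normr_eq0.
have xE : x = `|x| *: (`|x|^-1 *: x) by rewrite scalerA mulfV ?scale1r.
rewrite {1}xE linearZ normrZ normr_id scalar_reM// mulrC.
rewrite ler_wpM2r ?scalar_re_ge0// op_norm_ball//.
by rewrite normrZ normfV normr_id mulVf.
Qed.

Lemma op_normM S T : op_norm (S * T) <= op_norm S * op_norm T.
Proof.
apply: op_norm_le => x x1; rewrite bopME; apply: le_trans (op_normP _ _) _.
by rewrite ler_wpM2l ?op_norm_ge0// op_norm_ball.
Qed.

Lemma op_normN T : op_norm (- T) = op_norm T.
Proof.
by congr sup; apply: eq_imagel => x _; rewrite bopNE normrN.
Qed.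

End OperatorNorm.

(** * Perturbation of core inverses *)

Theorem theorem2p2 (R : realType) (k : scalar_kind) (X : hilbertType R k)
    (T Ts dT : bop X) :
  core_inverse T Ts ->
  invertible (1 + Ts * dT) ->
  [/\ invertible (1 + dT * Ts),
      Ts * bop_inv (1 + dT * Ts) = bop_inv (1 + Ts * dT) * Ts &
      let Tb := T + dT in
      let B := Ts * bop_inv (1 + dT * Ts) in
      [<-> core_inverse Tb B;
           range Tb `<=` range T;
           range Tb = range T;
           T * Ts * Tb = Tb;
           T * Ts * dT = dT] /\
      (core_inverse Tb B ->
       [/\ Tb * B = T * Ts,
           op_norm B <= op_norm Ts * op_norm (bop_inv (1 + Ts * dT)) &
           op_norm (B - Ts) <=
             op_norm Ts * op_norm (bop_inv (1 + Ts * dT)) *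
             op_norm (Ts * dT)])].
Proof.
move=> [TST rS nS] iSD.
have iDS := invertible_swap iSD.
have hU := bop_invP iSD; have hV := bop_invP iDS.
have BE := inverse_swap hU hV.
split=> //; move=> Tb B.
set U := bop_inv (1 + Ts * dT) in hU BE *.
set V := bop_inv (1 + dT * Ts) in hV BE B *.
have rB : range B = range T by rewrite (range_mulr _ (is_inverseC hV)).
have nB : null_space B = null_space Ts.
  by rewrite /B BE (null_space_mull _ (is_inverseC hU)).
have ii_iv : range Tb `<=` range T <-> T * Ts * Tb = Tb.
  exact: range_sub_inner_inverse.
have iv_v : T * Ts * Tb = Tb <-> T * Ts * dT = dT.
  by rewrite /Tb mulrDr TST; split=> [/addrI|->].
have TbE : T * Ts * dT = dT -> Tb = T * (1 + Ts * dT).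
  by move=> v; rewrite mulrDr mulr1 mulrA v.
have v_iii : T * Ts * dT = dT -> range Tb = range T.
  by move=> /TbE ->; exact: range_mulr hU.
have TbB : T * Ts * dT = dT -> Tb * B = T * Ts.
  by move=> /TbE ->; rewrite /B BE -mulrA (mulrA _ U) hU.1 mul1r.
have i_ii : core_inverse Tb B -> range Tb `<=` range T.
  by case=> _ rBTb _; rewrite -rBTb rB.
split.
  tfae => //.
  - by move=> /ii_iv/iv_v/v_iii.
  - by move=> rTb; apply/ii_iv; rewrite rTb.
  - by move=> /iv_v.
  - move=> v; split; last 2 first.
    + by rewrite rB v_iii.
    + by rewrite nB nS; apply/esym/null_adjoint_range/v_iii.
    + by rewrite TbB//; exact/iv_v.
move=> /i_ii/ii_iv/iv_v v; split; first exact: TbB.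
  by rewrite /B BE mulrC; exact: op_normM.
have -> : B - Ts = - (U * (Ts * dT) * Ts).
  (* Ts = U * (1 + Ts * dT) * Ts, in which U * Ts is B. *)
  rewrite /B BE -[X in _ - X]mul1r -hU.2 mulrDr mulr1 mulrDl.
  by rewrite opprD addNKr.
rewrite op_normN; apply: le_trans (op_normM _ _) _.
rewrite mulrC -mulrA ler_wpM2l ?op_norm_ge0//; exact: op_normM.
Qed.
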